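(* Consider number fields $K$ with exactly $s$ real embeddings $\sigma_1,\dots,\sigma_s$ and $2t$ non-real complex embeddings $\sigma_{s+1},\dots,\sigma_{s+2t}$, labelled so that $\sigma_{s+t+j}=\overline{\sigma_{s+j}}$ for $1\le j\le t$, such that $1\le s<t$. For such a $K$ and a unit $u\in\mathcal O_K^*$, consider the conditions $$(\mathrm{i})\quad \sigma_j(u)\,|\sigma_{s+j}(u)|^2=1\ \text{ for each } j\in\{1,\dots,s\},\qquad (\mathrm{ii})\quad |\sigma_{s+j}(u)|=1\ \text{ for each } j\in\{s+1,\dots,t\}.$$ Then: (a) The smallest $d=s+2t$ for which there exist such a labelled number field $K$ (with $1\le s<t$) and a unit $u\in K$ of degree $d$ over $\mathbb Q$ satisfying (i) and (ii) is $d=12$. (b) For every such labelled number field $K$ (with $1\le s<t$), there is no group of units $U\subset\mathcal O_K^{*,+}$ of rank $s$ such that every $u\in U$ (not necessarily of degree $d=s+2t$) satisfies (i) and (ii).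
   Context: $\mathcal O_K$ is the ring of algebraic integers of $K$, $\mathcal O_K^*$ its group of units (a unit of $K$ means an element of $\mathcal O_K^*$), and $\mathcal O_K^{*,+}$ is the subgroup of totally positive units, i.e. those $u\in\mathcal O_K^*$ with $\sigma_j(u)>0$ for every real embedding $\sigma_j$, $1\le j\le s$. *)

(* Defs.v *)
From HB Require Import structures.
From mathcomp Require Import all_boot all_order all_algebra all_field.

Set Implicit Arguments.
Unset Strict Implicit.
Unset Printing Implicit Defensive.

Import Order.TTheory GRing.Theory Num.Theory.
Local Open Scope ring_scope.

(* A number field is a K : fieldExtType rat.  Its elements are algebraic, so
   every embedding of K in the complex numbers takes its values in algC.  The
   embeddings are numbered from 1, and sigma i is meaningful only for
   1 <= i <= s + 2t. *)
Record labelled_embeddings (K : fieldExtType rat) (s t : nat)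
    (sigma : nat -> {rmorphism K -> algC}) : Prop := LabelledEmbeddings {
  embeddings_distinct : forall i j,
    (1 <= i <= s + 2 * t)%N -> (1 <= j <= s + 2 * t)%N ->
    sigma i =1 sigma j -> i = j;
  embeddings_exhaustive : forall tau : {rmorphism K -> algC},
    exists2 i, (1 <= i <= s + 2 * t)%N & tau =1 sigma i;
  embeddings_real : forall i,
    (1 <= i <= s)%N -> forall x : K, sigma i x \is Num.real;
  embeddings_nonreal : forall i,
    (s < i <= s + 2 * t)%N -> exists x : K, sigma i x \isn't Num.real;
  embeddings_conj : forall j,
    (1 <= j <= t)%N -> forall x : K, sigma (s + t + j)%N x = (sigma (s + j)%N x)^*
}.

Section Units.

Variable K : fieldExtType rat.

Definition alg_integer (x : K) : Prop :=
  integralOver (fun m : int => m%:~R : K) x.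

Definition int_unit (u : K) : Prop :=
  [/\ u != 0, alg_integer u & alg_integer u^-1].

(* In algC, 0 < z entails that z is real. *)
Definition totally_positive_unit (s : nat)
    (sigma : nat -> {rmorphism K -> algC}) (u : K) : Prop :=
  int_unit u /\ forall j, (1 <= j <= s)%N -> 0 < sigma j u.

Definition condition_i (s : nat) (sigma : nat -> {rmorphism K -> algC})
    (u : K) : Prop :=
  forall j, (1 <= j <= s)%N -> sigma j u * `|sigma (s + j)%N u| ^+ 2 = 1.

Definition condition_ii (s t : nat) (sigma : nat -> {rmorphism K -> algC})
    (u : K) : Prop :=
  forall j, (s + 1 <= j <= t)%N -> `|sigma (s + j)%N u| = 1.

(* U is a subgroup of the multiplicative group of K contained in P. *)
Definition mul_subgroup_of (P U : K -> Prop) : Prop :=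
  [/\ forall u, U u -> P u,
      U 1,
      forall u v, U u -> U v -> U (u * v)
    & forall u, U u -> U u^-1].

Definition mul_independent (n : nat) (v : 'I_n -> K) : Prop :=
  forall a : 'I_n -> int, \prod_(i < n) v i ^ a i = 1 -> forall i, a i = 0.

(* The torsion-free rank of an abelian group: the largest number of
   multiplicatively independent elements. *)
Definition mul_rank (U : K -> Prop) (r : nat) : Prop :=
  (exists v : 'I_r -> K, (forall i, U (v i)) /\ mul_independent v) /\
  (forall n (v : 'I_n -> K),
     (forall i, U (v i)) -> mul_independent v -> (n <= r)%N).

End Units.

Definition degree_attained (d : nat) : Prop :=
  exists (K : fieldExtType rat) (s t : nat)
         (sigma : nat -> {rmorphism K -> algC}) (u : K),
    labelled_embeddings s t sigma /\
    (1 <= s < t)%N /\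
    d = (s + 2 * t)%N /\
    int_unit u /\
    adjoin_degree 1%AS u = d /\
    condition_i s sigma u /\
    condition_ii s t sigma u.

(* Main.v *)
Require Import Defs.
From mathcomp Require Import all_boot all_order all_algebra all_field.
From HB Require Import structures.
From mathcomp Require Import ring zify.
From Stdlib Require Import Classical_Prop.

(* Part (b).  Since [s < t], condition (ii) puts a conjugate of [u] on the unit
   circle, where inversion is complex conjugation; hence the conjugates of [u]
   are closed under inversion.  Looking at the largest and the smallest
   [sigma_j u] with [j <= s], this forces [sigma_j u * sigma_k u = 1] for some
   [j, k <= s].  So [U] is the union of the kernels of finitely many characters
   [sigma_j * sigma_k] with values in the positive reals, and one of them is
   trivial on [U].  But then the absolute values of the conjugates of [u \in U]
   are determined by [s - 1] of them, and the box principle bounds the rank of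
   [U] by [s - 1].

   Part (a), lower bound.  For [u] of full degree the involution [z |-> z^-1] has
   no fixed point on the real conjugates, so that [s] is even and only
   [(s, t) = (2, 3)] and [(2, 4)] have [d < 12].  Sending the real conjugate [b]
   to a conjugate [d] on the unit circle transports [b * g * g^* = 1], and
   comparing absolute values leaves only [d = g / g^*] and [d = g^* / g].  This
   excludes two pairs of conjugates on the circle, and for a single pair an
   automorphism with [g |-> d] gives a contradiction.

   Part (a), [d = 12].  Over [Q(y)] with [y^4 = 6 y^2 + 3] take a root of
   [x^3 - y x^2 - y x - 1].  The three roots always have product 1; [y |-> -y]
   inverts them; for [y^2 = 3 + 2 sqrt 3] they are [b], [g], [g^*] with [b] real, and for
   [y^2 = 3 - 2 sqrt 3] they all lie on the unit circle.  The norm to [Q] is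
   [(x^3 - 1)^4 - 6 (x^3 - 1)^2 (x^2 + x)^2 - 3 (x^2 + x)^4], which is
   Eisenstein at 3 after [x |-> x + 1]. *)

Set Implicit Arguments.
Unset Strict Implicit.
Unset Printing Implicit Defensive.

Import Order.TTheory GRing.Theory Num.Theory.
Local Open Scope ring_scope.

(** * Automorphisms of the algebraic numbers *)

Lemma minCpoly_rmorph (K : fieldExtType rat) (f : {rmorphism K -> algC}) u :
  map_poly f (minPoly 1%AS u) = minCpoly (f u).
Proof.
have [p [Dp mon_p] dvp] := minCpolyP (f u).
apply/eqP; rewrite -eqp_monic ?minCpoly_monic ?map_monic ?monic_minPoly //.
have Qf (q : {poly rat}) : map_poly f (map_poly (in_alg K) q) = map_poly ratr q.
  rewrite -map_poly_comp; apply: eq_map_poly => a /=.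
  by rewrite rmorphZ_num rmorph1 mulr1.
rewrite /eqp; apply/andP; split.
  rewrite Dp -Qf dvdp_map minPoly_dvdp //.
    by apply/polyOverP => i; rewrite coef_map memvZ ?mem1v.
  by rewrite -(fmorph_root f) Qf dvp dvdpp.
have /polyOver1P[q Dq] := minPolyOver 1%AS u.
rewrite Dq Qf Dp dvdp_map -dvp -Qf -Dq fmorph_root; exact: root_minPoly.
Qed.

(** The conjugates of [x] generate a normal number field; its automorphisms act transitively on them
    and extend to [algC]. *)
Lemma conj_aut (x y : algC) : root (minCpoly x) y ->
  {nu : {rmorphism algC -> algC} | nu x = y}.
Proof.
move=> ry; have [p [Dp mon_p] dvp] := minCpolyP x.
have [r Dr] := closed_field_poly_normal (minCpoly x).
rewrite (monicP (minCpoly_monic x)) scale1r in Dr.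
have [L [LC [rr Drr genL]]] := num_field_exists r.
pose pr := map_poly (in_alg L) p.
have Dpr : map_poly LC pr = minCpoly x.
  rewrite Dp -map_poly_comp; apply: eq_map_poly => a /=.
  by rewrite rmorphZ_num rmorph1 mulr1.
have Lax : SplittingField.axiom L.
  exists pr; first by apply/polyOverP=> i; rewrite coef_map memvZ ?mem1v.
  exists rr => //; congr (_ %= _): (eqpxx pr); apply/(map_poly_inj LC).
  rewrite Dpr Dr -Drr big_map rmorph_prod /=; apply: eq_bigr => z _.
  by rewrite map_polyXsubC.
pose Ls : splittingFieldType rat := HB.pack L (FieldExt_isSplittingField.Build _ L Lax).
have inL z : root (minCpoly x) z -> {zz : Ls | LC zz = z}.
  by rewrite Dr root_prod_XsubC -Drr => /mapP/sig2_eqW[zz _ ->]; exists zz.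
have [xx Dx] := inL x (root_minCpoly x).
have [yy Dy] := inL y ry.
have rxy : root (minPoly 1%AS xx) yy.
  by rewrite -(fmorph_root (LC : {rmorphism Ls -> algC})) minCpoly_rmorph Dx Dy.
have /sig2_eqW[g _ gx] :=
  normalField_root_minPoly (sub1v _) (normalFieldf (1%AS : {subfield Ls})) (memvf xx) rxy.
have [nu Dnu] := extend_algC_subfield_aut (LC : {rmorphism Ls -> algC}) g.
by exists nu; rewrite -Dx -Dy -gx (Dnu xx).
Qed.

(** * Integers with bounded conjugates and the box principle *)

Lemma coef_prod_XsubC_le (B : nat) (r : seq algC) i :
    (forall y, y \in r -> `|y| <= B%:R) ->
  `|(\prod_(y <- r) ('X - y%:P))`_i| <= (B.+1 ^ size r)%:R.
Proof.
elim: r i => [|y r IHr] i rB.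
  by rewrite big_nil coef1; case: (i == _); rewrite ?normr1 ?normr0.
have {}IHr j := IHr j (fun z rz => rB z (mem_behead (s := y :: r) rz)).
rewrite big_cons mulrBl coefB coefXM coefCM expnS mulSn natrD.
apply: le_trans (ler_normB _ _) _; apply: lerD.
  by case: (i == _); rewrite ?normr0.
by rewrite normrM natrM ler_pM // rB ?mem_head.
Qed.

(** Bounded conjugates bound the coefficients of the minimal polynomial; these are integers, so only
    finitely many polynomials occur. *)
Lemma bounded_Aint_finite (n B : nat) :
  exists T : seq algC, forall x, x \in Aint -> (size (minCpoly x) <= n.+1)%N ->
    (forall y, root (minCpoly x) y -> `|y| <= B%:R) -> x \in T.
Proof.
pose M := (B.+1 ^ n)%N.
(* Integer coefficients in [[-M, M]] are shifted by [M], so that coefficient vectors range over a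
   finite type. *)
pose P (a : {ffun 'I_n.+1 -> 'I_(M.*2.+1)}) : {poly algC} :=
  \poly_(i < n.+1) ((a (inord i))%:R - M%:R).
exists (flatten [seq sval (closed_field_poly_normal (P a)) | a : {ffun _ -> _}]).
move=> x Ax szx rB.
have [r Dr] := closed_field_poly_normal (minCpoly x).
rewrite (monicP (minCpoly_monic x)) scale1r in Dr.
have coefM i : `|(minCpoly x)`_i| <= M%:R.
  rewrite Dr; apply: le_trans (coef_prod_XsubC_le _ _) _.
    by move=> y ry; apply: rB; rewrite Dr root_prod_XsubC.
  rewrite ler_nat leq_pexp2l // -ltnS.
  by rewrite -(size_prod_XsubC r id) -Dr.
have coefZ i : {k : 'I_(M.*2.+1) | (minCpoly x)`_i = k%:R - M%:R}.
  apply: sig_eqW.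
  have /intrP[z Dz] : (minCpoly x)`_i \in Num.int by apply: (polyOverP Ax).
  have := coefM i; rewrite Dz -intr_norm -[M%:R]/(M%:Z%:~R) ler_int => zM.
  have zM0 : 0 <= z + M%:Z by lia.
  have ltk : (absz (z + M%:Z)%R < M.*2.+1)%N by lia.
  exists (Ordinal ltk) => /=.
  by rewrite -[(absz _)%:R]/((absz (z + M%:Z)%R)%:Z%:~R) gez0_abs // intrD addrK.
pose a : {ffun 'I_n.+1 -> 'I_(M.*2.+1)} := [ffun i : 'I_n.+1 => sval (coefZ i)].
have DP : P a = minCpoly x.
  apply/polyP => i; rewrite coef_poly; case: ltnP => ltin.
    by rewrite ffunE inordK //; case: (coefZ i).
  by rewrite nth_default // (leq_trans szx).
apply/flattenP; exists (sval (closed_field_poly_normal (P a))).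
  by apply: map_f; rewrite mem_enum.
case: (closed_field_poly_normal _) => r1 /= Dr1.
have := root_minCpoly x; rewrite -DP Dr1 rootZ ?root_prod_XsubC //.
by rewrite lead_coef_eq0 DP minCpoly_eq0.
Qed.

Lemma pigeonhole_fiber (S T : finType) (f : S -> T) k :
  (k * #|T| < #|S|)%N -> exists t, (k < #|[set x | f x == t]|)%N.
Proof.
move=> ltkS; apply/existsP; apply: contraLR ltkS => /existsPn small.
rewrite -leqNgt -sum1_card (partition_big f xpredT) //= mulnC -sum_nat_const.
by apply: leq_sum => t _; rewrite sum1dep_card leqNgt small.
Qed.

Lemma pow2_log_box (x : algC) m : 1 <= x -> x <= 2 ^+ m ->
  let k := trunc_log 2 (Num.truncn x) in
  [/\ (k <= m)%N, 2 ^+ k <= x & x < 2 ^+ k.+1].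
Proof.
move=> x1 xm; have x0 : 0 <= x := le_trans ler01 x1.
have /andP[tx xt] := truncn_itv x0.
have t1 : (0 < Num.truncn x)%N by rewrite truncn_gt0.
have /andP[kt tk] := trunc_log_bounds (isT : (1 < 2)%N) t1.
rewrite /=; set k := trunc_log _ _ in kt tk *.
have kx : 2 ^+ k <= x by rewrite (le_trans _ tx) // -natrX ler_nat.
split=> //; last by rewrite (lt_le_trans xt) // -natrX ler_nat.
rewrite -(leq_exp2l _ _ (isT : (1 < 2)%N)) -(ler_nat algC) !natrX.
exact: le_trans xm.
Qed.

(* Box principle in the multiplicative form: each of the [#|J|] coordinates is
   cut into the intervals [[2^k, 2^(k+1)[], and [#|J| < s] makes the exponent
   vectors outnumber the boxes. *)
Lemma close_monomials (s : nat) (J : finType) (F : 'I_s -> J -> algC) k :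
    (forall i j, 0 < F i j) -> (#|J| < s)%N ->
  exists N (A : {set {ffun 'I_s -> 'I_N}}), (k < #|A|)%N /\
    forall a b, a \in A -> b \in A ->
    forall j, \prod_i F i j ^+ a i < 2 * \prod_i F i j ^+ b i.
Proof.
move=> F0 ltJs.
have archi (x : algC) : 0 < x -> x <= 2 ^+ Num.bound x.
  move=> x0; apply/ltW/(lt_trans (archi_boundP (ltW x0))).
  by rewrite -natrX ltr_nat ltn_expl.
(* [C] is chosen so that every [F i j] lies between [2 ^- C] and [2 ^+ C]. *)
pose c i j := (Num.bound (F i j) + Num.bound (F i j)^-1)%N.
pose C := (\sum_i \sum_j c i j)%N.
have lecC i j : (c i j <= C)%N.
  by rewrite /C (bigD1 i) //= (bigD1 j) //= -addnA leq_addr.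
have le2X (m n : nat) : (m <= n)%N -> 2 ^+ m <= 2 ^+ n :> algC.
  by move=> lemn; rewrite ler_weXn2l // ler1n.
have FC i j : F i j <= 2 ^+ C.
  apply: le_trans (archi _ (F0 i j)) _; apply: le2X.
  by apply: leq_trans (lecC i j); rewrite leq_addr.
have FC' i j : 1 <= 2 ^+ C * F i j.
  have Vle : (F i j)^-1 <= 2 ^+ C.
    apply: le_trans (archi _ _) _; rewrite ?invr_gt0 //; apply: le2X.
    by apply: leq_trans (lecC i j); rewrite leq_addl.
  have := ler_wpM2r (ltW (F0 i j)) Vle.
  by rewrite mulVf ?lt0r_neq0.
(* The [N ^ s] exponent vectors fall into at most [(2 * C * s + 1) ^ #|J| * N ^ #|J|] boxes. As
   [#|J| < s], taking [N] above [k * (2 * C * s + 1) ^ #|J|] forces more than [k] vectors into one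
   box. *)
pose D := (k * (2 * C * s).+1 ^ #|J|)%N; pose N := D.+1.
(* The factors [2 ^+ (C * N)] make every product at least 1, as [pow2_log_box] requires, and cancel
   at the end. *)
pose X (a : {ffun 'I_s -> 'I_N}) j : algC := \prod_i (2 ^+ (C * N) * F i j ^+ a i).
have XE a j : X a j = 2 ^+ (C * N * s) * \prod_i F i j ^+ a i.
  by rewrite /X big_split /= prodr_const card_ord -exprM.
have aN (a : {ffun 'I_s -> 'I_N}) i : (a i <= N)%N := ltnW (ltn_ord (a i)).
have X1 a j : 1 <= X a j.
  rewrite /X; elim/big_ind: _ => // [x y x1 y1|i _]; first exact: mulr_ege1.
  move: (nat_of_ord (a i)) (aN a i) => e /subnKC <-.
  rewrite mulnDr exprD mulrAC exprM -exprMn.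
  by rewrite mulr_ege1 // exprn_ege1 // ?exprn_ege1 // ler1n.
have XN a j : X a j <= 2 ^+ (2 * C * s * N).
  rewrite XE (_ : 2 * C * s * N = C * N * s + C * N * s)%N; last by ring.
  rewrite exprD ler_wpM2l ?exprn_ge0 // exprM -[X in _ ^+ X]card_ord -prodr_const.
  apply: ler_prod => i _; rewrite exprn_ge0 ?(ltW (F0 _ _)) //=.
  rewrite exprM (le_trans (lerXn2r _ _ _ (FC i j))) ?nnegrE ?exprn_ge0 ?(ltW (F0 _ _)) //.
  by rewrite ler_weXn2l // exprn_ege1 // ler1n.
have box a j := pow2_log_box (X1 a j) (XN a j).
pose f a : {ffun J -> 'I_(2 * C * s * N).+1} :=
  [ffun j => inord (trunc_log 2 (Num.truncn (X a j)))].
have [|t kA] := @pigeonhole_fiber _ _ f k.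
  rewrite !card_ffun !card_ord.
  have lt1 : ((2 * C * s * N).+1 ^ #|J| <= (2 * C * s).+1 ^ #|J| * N ^ #|J|)%N.
    by rewrite -expnMn; case: #|J| => [|e] //; rewrite leq_exp2r // mulSn; lia.
  apply: leq_ltn_trans (leq_mul (leqnn k) lt1) _.
  rewrite mulnA -/D; apply: leq_trans (_ : N * N ^ #|J| <= _)%N.
    by rewrite ltn_pmul2r ?expn_gt0.
  by rewrite -expnS leq_pexp2l.
exists N, [set x | f x == t]; split=> // a b; rewrite !inE => /eqP fa /eqP fb j.
have [ka _ ltX] := box a j; have [kb leX _] := box b j.
have eqk : trunc_log 2 (Num.truncn (X a j)) = trunc_log 2 (Num.truncn (X b j)).
  have /ffunP/(_ j)/(congr1 val) : f a = f b by rewrite fa fb.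
  by rewrite !ffunE /= !inordK.
have : X a j < 2 * X b j.
  by rewrite (lt_le_trans ltX) // eqk exprS ler_wpM2l.
by rewrite !XE mulrCA ltr_pM2l ?exprn_gt0.
Qed.

(** * Units on the unit circle *)

Lemma minCpoly_emb (K : fieldExtType rat) (f g : {rmorphism K -> algC}) u :
  minCpoly (f u) = minCpoly (g u).
Proof.
have /polyOver1P[q Dq] := minPolyOver 1%AS u.
rewrite -!minCpoly_rmorph Dq -!map_poly_comp; apply: eq_map_poly => a /=.
by rewrite !rmorphZ_num !rmorph1.
Qed.

Lemma emb_aut (K : fieldExtType rat) (f g : {rmorphism K -> algC}) u :
  {nu : {rmorphism algC -> algC} | nu (f u) = g u}.
Proof. by apply: conj_aut; rewrite (minCpoly_emb f g) root_minCpoly. Qed.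

Lemma alg_integer_Aint (K : fieldExtType rat) (f : {rmorphism K -> algC}) x :
  alg_integer x -> f x \in Aint.
Proof.
case=> p mon_p px0; apply: (@root_monic_Aint (map_poly intr p)).
- have -> : map_poly intr p = map_poly f (map_poly intr p).
    by rewrite -map_poly_comp; apply: eq_map_poly => z /=; rewrite rmorph_int.
  by rewrite fmorph_root.
- exact: monic_map.
- by apply/polyOverP => i; rewrite coef_map /= intr_int.
Qed.

Lemma inv_norm1 (z : algC) : `|z| = 1 -> z^-1 = z^*.
Proof.
move=> z1; have z0 : z != 0 by rewrite -normr_eq0 z1 oner_eq0.
by apply: (mulfI z0); rewrite mulfV // -normCK z1 expr1n.
Qed.

Section Embeddings.

Variables (K : fieldExtType rat) (s t : nat) (sigma : nat -> {rmorphism K -> algC}).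
Hypothesis sigmaP : labelled_embeddings s t sigma.

Lemma emb_norm_cases i x : (1 <= i <= s + 2 * t)%N ->
  (i <= s)%N \/ exists2 k, (1 <= k <= t)%N & `|sigma i x| = `|sigma (s + k)%N x|.
Proof.
move=> /andP[i1 it]; case: (leqP i s) => [|lt_si]; [by left | right].
have [le_it | lt_it] := leqP i (s + t).
  by exists (i - s)%N; [lia | rewrite subnKC // ltnW].
exists (i - (s + t))%N; first lia.
rewrite -[RHS]norm_conjC -(embeddings_conj sigmaP); last lia.
by rewrite subnKC // ltnW.
Qed.

(* [sigma_(2s+1) u] lies on the unit circle, so that its inverse is its complex
   conjugate; every other conjugate of [u] inherits this. *)
Lemma inverse_conjugate (f : {rmorphism K -> algC}) u :
    (s < t)%N -> condition_ii s t sigma u ->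
  exists2 i, (1 <= i <= s + 2 * t)%N & sigma i u = (f u)^-1.
Proof.
move=> ltst u2; have [nu nuE] := emb_aut (sigma (s + (s + 1))%N) f u.
have d1 : `|sigma (s + (s + 1))%N u| = 1 by apply: u2; lia.
pose tau : {rmorphism K -> algC} :=
  nu \o (Num.conj : {rmorphism algC -> algC}) \o sigma (s + (s + 1))%N.
have [i ib itau] := embeddings_exhaustive sigmaP tau.
by exists i; rewrite // -itau /= -(inv_norm1 d1) fmorphV nuE.
Qed.

Lemma norm_cond_i u j : (1 <= j <= s)%N -> condition_i s sigma u ->
  `|sigma (s + j)%N u| ^+ 2 = (sigma j u)^-1.
Proof.
move=> js /(_ j js) E; have j0 : sigma j u != 0.
  by apply: contra_eq_neq E => ->; rewrite mul0r eq_sym oner_eq0.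
by apply: (mulfI j0); rewrite E mulfV.
Qed.

(** Without such a pair, the inverse of a real conjugate [sigma j u] has the absolute value of some
    [sigma (s + k) u]. By (ii), [k > s] would give [u = 1]; by (i), [k <= s] gives
    [sigma k u = sigma j u ^+ 2]. So the real conjugates are closed under squaring. *)
Lemma inverse_pair u :
    (1 <= s < t)%N -> condition_i s sigma u -> condition_ii s t sigma u ->
    (forall j, (1 <= j <= s)%N -> 0 < sigma j u) -> u != 1 ->
  exists j k : 'I_s, sigma j.+1 u * sigma k.+1 u = 1.
Proof.
case/andP=> s1 lt_st u1 u2 u0 un1.
have sig_n1 (j : 'I_s) : sigma j.+1 u != 1 by rewrite fmorph_eq1.
have sig_gt0 (j : 'I_s) : 0 < sigma j.+1 u by apply: u0; rewrite /= ltn_ord.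
suff /existsP[j /existsP[k /eqP jk]] :
  [exists j : 'I_s, exists k : 'I_s, sigma j.+1 u * sigma k.+1 u == 1].
  by exists j, k.
apply: contraT => /existsPn nopair.
have sq (j : 'I_s) : exists k : 'I_s, sigma k.+1 u = sigma j.+1 u ^+ 2.
  have [i ib iE] := inverse_conjugate (sigma j.+1) lt_st u2.
  have {}iE : sigma j.+1 u * sigma i u = 1 by rewrite iE mulfV // lt0r_neq0.
  have [le_is | [k kt kE]] := emb_norm_cases u ib.
    have lti : (i.-1 < s)%N by lia.
    have /existsPn/(_ (Ordinal lti))/= := nopair j.
    by rewrite prednK ?iE ?eqxx //; lia.
  have := congr1 (fun z => `|z|) iE.
  rewrite normrM normr1 kE (gtr0_norm (sig_gt0 j)).
  have [le_ks | lt_sk] := leqP k s; last first.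
    rewrite u2 ?mulr1; last lia.
    by move/eqP; rewrite (negPf (sig_n1 j)).
  move/(congr1 (fun z => z ^+ 2)); rewrite exprMn expr1n norm_cond_i ?le_ks //; last lia.
  move=> E; have ltk : (k.-1 < s)%N by lia.
  exists (Ordinal ltk); rewrite /= prednK; last lia.
  have k0 : 0 < sigma k u by apply: u0; lia.
  by apply: (mulIf (invr_neq0 (lt0r_neq0 k0))); rewrite E mulfV // lt0r_neq0.
(* The largest value is not 1 and its square does not exceed it, so all values are below 1; then the
   square of the smallest is smaller still. *)
have i0 : 'I_s by exact: (Ordinal s1).
have sig_real (j : 'I_s) : j \in predT -> sigma j.+1 u \is Num.real by rewrite gtr0_real.
have [J _ Jmax] := real_arg_maxP (isT : predT i0) sig_real.
have J1 : sigma J.+1 u < 1.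
  rewrite lt_neqAle sig_n1 -(ler_pM2l (sig_gt0 J)) mulr1 -expr2.
  by have [k <-] := sq J; apply: Jmax.
have [I _ Imin] := real_arg_minP (isT : predT i0) sig_real.
have I1 : sigma I.+1 u < 1 := le_lt_trans (Jmax I isT) J1.
have [k kE] := sq I.
have kI : sigma k.+1 u < sigma I.+1 u by rewrite kE expr2 gtr_pMl.
by have := le_lt_trans (Imin k isT) kI; rewrite ltxx.
Qed.
End Embeddings.

(* If [u] escapes the kernels in [L] and [w] escapes that of [i], then
   [u ^+ n * w] escapes all of them for all but finitely many [n]. *)
Lemma escape_kernels (K : fieldType) (U : K -> Prop) (I : eqType)
    (phi : I -> K -> algC) (L : seq I) :
    U 1 -> (forall u v, U u -> U v -> U (u * v)) ->
    (forall i u v, phi i (u * v) = phi i u * phi i v) ->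
    (forall i, phi i 1 = 1) -> (forall i u, U u -> 0 < phi i u) ->
    (forall i, exists2 u, U u & phi i u != 1) ->
  exists2 u, U u & forall i, i \in L -> phi i u != 1.
Proof.
move=> U1 UM phiM phi1 phi0 phin; elim: L => [|i L [u Uu uL]]; first by exists 1.
have [iu1 | iun1] := eqVneq (phi i u) 1; last first.
  by exists u => // j; rewrite inE => /predU1P[-> | /uL].
have [w Uw iw] := phin i.
have UX n : U (u ^+ n) by elim: n => [|n IHn]; rewrite ?expr0 // exprS; apply: UM.
have phiX j n : phi j (u ^+ n) = phi j u ^+ n.
  by elim: n => [|n IHn]; rewrite ?expr0 ?phi1 // !exprS phiM IHn.
suff [n nL] : exists n, all (fun j => phi j u ^+ n * phi j w != 1) L.
  exists (u ^+ n * w); first exact: UM.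
  move=> j; rewrite inE phiM phiX => /predU1P[-> | jL]; last exact: (allP nL).
  by rewrite iu1 expr1n mul1r.
(* A bad [n] names a [j] in [L] with [phi j u ^+ n * phi j w = 1]. Among [size L + 1] exponents two
   would share [j], but the powers of [phi j u], positive and not 1, are distinct. *)
suff /existsP[n nL] : [exists n : 'I_(size L).+1,
    all (fun j => phi j u ^+ n * phi j w != 1) L] by exists n.
apply: contraT => /existsPn bad.
pose b (n : nat) j := phi j u ^+ n * phi j w == 1.
have {}bad (n : 'I_(size L).+1) : (find (b n) L < size L)%N.
  rewrite -has_find; have := bad n.
  by rewrite -has_predC (eq_has (a2 := b n)) // => j /=; rewrite negbK.
have [|k] := @pigeonhole_fiber _ _ (fun n => Ordinal (bad n)) 1.
  by rewrite !card_ord mul1n.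
case/card_gt1P=> m [n []]; rewrite !inE => /eqP/(congr1 val)/= km /eqP/(congr1 val)/= kn.
case/negP; apply/eqP/val_inj.
have bm := nth_find i (s := L) (a := b m); have bn := nth_find i (s := L) (a := b n).
rewrite has_find bad km in bm; rewrite has_find bad kn in bn.
have kL : (k < size L)%N by [].
set j := nth i L k in bm bn.
have ju : phi j u != 1 by apply: uL; apply: mem_nth.
have jw : phi j w != 0 by rewrite lt0r_neq0 // phi0.
apply: (ieexprIn (phi0 j u Uu) ju); apply: (mulIf jw).
by rewrite (eqP (bm isT)) (eqP (bn isT)).
Qed.

(** * The rank bound for part (b) *)

Section Embeddings.

Variables (K : fieldExtType rat) (s t : nat) (sigma : nat -> {rmorphism K -> algC}).
Hypothesis sigmaP : labelled_embeddings s t sigma.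

Lemma prodX_inj (v : 'I_s -> K) (a b : 'I_s -> nat) :
    (forall i, v i != 0) -> mul_independent v ->
  \prod_i v i ^+ a i = \prod_i v i ^+ b i -> a =1 b.
Proof.
move=> v0 vI E i.
suff /(_ i)/eqP : forall i, (a i)%:Z - (b i)%:Z = 0 by rewrite subr_eq0 => /eqP[].
apply: (vI (fun i => (a i)%:Z - (b i)%:Z)).
have vab j : v j ^ ((a j)%:Z - (b j)%:Z) = v j ^+ a j / v j ^+ b j.
  by rewrite (expfzDr _ _ (v0 j)) -exprnN.
under eq_bigr do rewrite vab.
rewrite big_split /= prodfV E divff //.
by apply/prodf_neq0 => j _; rewrite expf_neq0 ?v0.
Qed.

(** If the character were trivial, the real coordinates other than [j1] would control all absolute
    values. The box principle then yields more than [size T] units with all conjugates bounded by 2,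
    where [T] holds all such integers; two coincide, against independence. *)
Lemma character_nontrivial (U : K -> Prop) (j1 j2 : 'I_s) :
    (1 <= s < t)%N -> mul_subgroup_of (totally_positive_unit s sigma) U ->
    mul_rank U s ->
    (forall u, U u -> condition_i s sigma u /\ condition_ii s t sigma u) ->
  ~ forall u, U u -> sigma j1.+1 u * sigma j2.+1 u = 1.
Proof.
case/andP=> s1 lt_st [Upos U1 UM UV] [[v [Uv vI]] _] Ucond triv.
have U0 u : U u -> u != 0 by case/Upos => -[].
have sig_gt0 u (j : 'I_s) : U u -> 0 < sigma j.+1 u.
  by case/Upos => _; apply; rewrite /= ltn_ord.
have Uprod (a : 'I_s -> nat) : U (\prod_i v i ^+ a i).
  elim/big_ind: _ => // i _.
  by elim: (a i) => [|n IHn]; rewrite ?expr0 // exprS; apply: UM.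
pose J := {j : 'I_s | j != j1}.
have cardJ : (#|{: J}| < s)%N.
  by rewrite card_sig (eq_card (B := predC1 j1)) // cardC1 card_ord ltn_predL.
have [T TP] := bounded_Aint_finite (\dim {:K}) 2.
pose F i (j : J) := sigma (val j).+1 (v i).
have [|N [A [cardA closeA]]] := close_monomials (size T) (F := F) _ cardJ.
  by move=> i j; apply: sig_gt0.
pose m (a : {ffun 'I_s -> 'I_N}) := \prod_i v i ^+ a i.
have Um c : U (m c) by apply: Uprod.
(* At [j1]: for [j2 = j1] the positive value has square 1; otherwise [sigma j1 (m a / m b)] equals
   [sigma j2 (m b / m a)], which is already bounded. *)
have close a b (j : 'I_s) : a \in A -> b \in A -> sigma j.+1 (m a / m b) < 2.
  have close' a' b' (k : 'I_s) : a' \in A -> b' \in A -> k != j1 ->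
      sigma k.+1 (m a' / m b') < 2.
    move=> Aa' Ab' kj; have := closeA a' b' Aa' Ab' (Sub k kj).
    have FE (c : {ffun 'I_s -> 'I_N}) : \prod_i F i (Sub k kj) ^+ c i = sigma k.+1 (m c).
      by rewrite /m rmorph_prod; apply: eq_bigr => i _; rewrite rmorphXn.
    rewrite !FE fmorph_div ltr_pdivrMr //; exact/sig_gt0/Um.
  move=> Aa Ab; have [->{j} | ] := eqVneq j j1; last exact: close'.
  have Uab : U (m a / m b) by apply: UM; try apply: UV; apply: Um.
  have jj := triv _ Uab.
  have [j21 | j2n1] := eqVneq j2 j1.
    have /eqP := jj; rewrite j21 -expr2 sqrp_eq1 ?ltW ?sig_gt0 // => /eqP ->.
    by rewrite ltr1n.
  have := close' b a j2 Ab Aa j2n1.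
  have -> : m b / m a = (m a / m b)^-1 by rewrite invf_div.
  have j20 := lt0r_neq0 (sig_gt0 _ j2 Uab).
  by rewrite fmorphV -(mulr1 _^-1) -jj mulrCA mulVf ?mulr1.
have /card_gt0P[a0 Aa0] : (0 < #|A|)%N by apply: leq_ltn_trans cardA.
pose g a := sigma 1 (m a / m a0).
have gT a : a \in A -> g a \in T.
  move=> Aa; have Ux : U (m a / m a0) by apply: UM; try apply: UV; apply: Um.
  apply: TP.
  - by apply: alg_integer_Aint; case/Upos: Ux => -[].
  - rewrite -minCpoly_rmorph size_map_poly size_minPoly ltnS adjoin_degreeE dimv1 divn1.
    by rewrite dimvS ?subvf.
  move=> y; move/conj_aut => [nu <-].
  have [i ib] := embeddings_exhaustive sigmaP (nu \o sigma 1).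
  move/(_ (m a / m a0)) => /= ->.
  have [cond1 cond2] := Ucond _ Ux.
  have [le_is | [k kt ->]] := emb_norm_cases sigmaP (m a / m a0) ib.
    have lti : (i.-1 < s)%N by lia.
    have := close a a0 (Ordinal lti) Aa Aa0; rewrite /= prednK; last lia.
    rewrite gtr0_norm; first exact: ltW.
    by have := sig_gt0 _ (Ordinal lti) Ux; rewrite /= prednK //; lia.
  have [le_ks | lt_sk] := leqP k s; last by rewrite cond2 ?ler1n //; lia.
  have ltk : (k.-1 < s)%N by lia.
  have := close a0 a (Ordinal ltk) Aa0 Aa; rewrite /= prednK; last lia.
  have ks : (1 <= k <= s)%N by lia.
  (* By (i), the squared absolute value at [s + k] is the value of the inverse quotient at [k],
     hence the swap of [a] and [a0]; it is below 2, and so below 4. *)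
  rewrite -[m a0 / m a]invf_div fmorphV -(norm_cond_i ks cond1).
  move/ltW => n2; rewrite -(ler_pXn2r (isT : (0 < 2)%N)) ?nnegrE //.
  by apply: le_trans n2 _; rewrite -natrX ler_nat.
suff : (size [seq g a | a <- enum A] <= size T)%N.
  by rewrite size_map -cardE leqNgt cardA.
apply: uniq_leq_size; last by move=> _ /mapP[a Aa ->]; apply: gT; rewrite mem_enum in Aa.
rewrite map_inj_in_uniq ?enum_uniq // => a b _ _ /fmorph_inj.
move/(mulIf (invr_neq0 (U0 _ (Um _))))/prodX_inj => ab.
by apply/ffunP => i; apply: val_inj; apply: ab => // j; apply: U0.
Qed.

End Embeddings.

Lemma no_unit_group_of_rank_s (K : fieldExtType rat) (s t : nat)
    (sigma : nat -> {rmorphism K -> algC}) (U : K -> Prop) :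
    labelled_embeddings s t sigma -> (1 <= s < t)%N ->
    mul_subgroup_of (totally_positive_unit s sigma) U -> mul_rank U s ->
  ~ forall u, U u -> condition_i s sigma u /\ condition_ii s t sigma u.
Proof.
move=> sigmaP st Usub Urk Ucond; have [Upos U1 UM _] := Usub.
have sig_gt0 u (j : 'I_s) : U u -> 0 < sigma j.+1 u.
  by case/Upos => _; apply; rewrite /= ltn_ord.
pose phi (p : 'I_s * 'I_s) x := sigma p.1.+1 x * sigma p.2.+1 x.
have [||||u Uu nopair] :=
    @escape_kernels K U _ phi (enum {: 'I_s * 'I_s}) U1 UM.
- by move=> p u v; rewrite /phi !rmorphM mulrACA.
- by move=> p; rewrite /phi !rmorph1 mulr1.
- by move=> p u Uu; rewrite mulr_gt0 ?sig_gt0.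
- move=> p; apply: NNPP => triv.
  have := character_nontrivial sigmaP (j1 := p.1) (j2 := p.2) st Usub Urk Ucond.
  apply=> u Uu; apply/eqP/contraT => phiu; case: triv; by exists u.
have [cond1 cond2] := Ucond u Uu.
have [||j [k jk]] := inverse_pair sigmaP st cond1 cond2.
- by case/Upos: Uu.
- have s0 : (0 < s)%N by case/andP: st.
  apply: contra_neq (nopair (Ordinal s0, Ordinal s0) (mem_enum _ _)) => ->.
  by rewrite /phi !rmorph1 mulr1.
by have := nopair (j, k) (mem_enum _ _); rewrite /phi jk eqxx.
Qed.

(** * The lower bound on the degree *)

Section TwoRealConjugates.

Variables b g d e : algC.
(** The conjugates of [u] for [(s, t) = (2, 4)]; the case [(2, 3)] is [e = d]. The hypothesis [autS]
    below is the transitivity of the Galois action on them. *)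
Let S := [:: b; b^-1; g; g^*; g^-1; (g^*)^-1; d; d^*; e; e^*].
Hypotheses (b_gt0 : 0 < b) (b_n1 : b != 1) (bgg : b * `|g| ^+ 2 = 1).
Hypotheses (d1 : `|d| = 1) (e1 : `|e| = 1).
Hypotheses (S1 : 1 \notin S) (SN1 : -1 \notin S) (g_nreal : g != g^*).
Hypothesis autS : forall x y, x \in S -> y \in S ->
  exists nu : {rmorphism algC -> algC}, nu x = y /\ forall z, z \in S -> nu z \in S.

Let g0 : g != 0.
Proof. by apply: contra_eq_neq bgg => ->; rewrite normr0 expr0n mulr0 eq_sym oner_eq0. Qed.

Let gC0 : g^* != 0. Proof. by rewrite conjC_eq0. Qed.

Let relC : b * g * g^* = 1. Proof. by rewrite -mulrA -normCK. Qed.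

Let norm_g : `|g| ^+ 2 = b ^ (-1).
Proof. by apply: (mulfI (lt0r_neq0 b_gt0)); rewrite bgg exprN1 mulfV // lt0r_neq0. Qed.

Let sq_n1 z : z \in S -> z * z != 1.
Proof.
move=> Sz; rewrite -expr2 sqrf_eq1; apply/norP.
by split; apply: contraTneq Sz => ->.
Qed.

(* The level of [z] is the exponent [k] such that [|z|^2 = b^k]. *)
Let level z : z \in S -> exists2 k : int, `|z| ^+ 2 = b ^ k &
  (k = 2 /\ z = b) \/ (k = -2 /\ z = b^-1) \/
  (k = -1 /\ (z = g \/ z = g^*)) \/ (k = 1 /\ (z = g^-1 \/ z = (g^*)^-1)) \/
  (k = 0 /\ z \in [:: d; d^*; e; e^*]).
Proof.
have nb : `|b| = b := gtr0_norm b_gt0.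
rewrite (mem_cat z [:: b; b^-1; g; g^*; g^-1; (g^*)^-1] [:: d; d^*; e; e^*]).
case/orP; last first.
  move=> Dz; exists 0; last by do 4!right.
  by move: Dz; rewrite !inE => /or4P[] /eqP->; rewrite ?norm_conjC ?d1 ?e1 expr1n.
rewrite !inE => /or4P[/eqP->|/eqP->|/eqP->|/or3P[] /eqP->].
- by exists 2; [rewrite nb | left].
- by exists (-2); [rewrite normfV nb exprVn | right; left].
- by exists (-1); [| right; right; left; split; auto].
- by exists (-1); [rewrite norm_conjC | right; right; left; split; auto].
- exists 1; [| right; right; right; left; split; auto].
  by rewrite normfV exprVn norm_g exprN1 invrK.
- exists 1; [| right; right; right; left; split; auto].
  by rewrite normfV exprVn norm_conjC norm_g exprN1 invrK.
Qed.

Let level_inj k : b ^ k = 1 -> k = 0.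
Proof.
move/eqP; rewrite pexprz_eq1 ?ltW // => /orP[/eqP//|/eqP b1].
by case/eqP: b_n1.
Qed.

(** The relation is an image of [b * g * g^* = 1]. Since [|d| = 1], the levels of [x] and [y] are
    opposite. Levels 2 and -2 give [x * y = 1], hence [d = 1]; level 0 leaves only [e] and [e^*],
    with the same outcome. Levels 1 and -1 give the two quotients, and for the first one [x] and [y]
    are recorded for [no_single_unit_pair]. *)
Let triple x y : d * x * y = 1 -> x \in S -> y \in S -> x != y -> x != d -> y != d ->
    (d = g / g^* /\ ((x = g^-1 /\ y = g^*) \/ (x = g^* /\ y = g^-1)))
    \/ (d = g^* / g).
Proof.
move=> dxy Sx Sy xy xd yd.
have d0 : d != 0 by rewrite -normr_eq0 d1 oner_eq0.
have dn1 : d != 1 by apply: contraNneq S1 => <-; rewrite !inE eqxx !orbT.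
have dpq p q : p * q = 1 -> d * p * q = 1 -> False.
  by rewrite -mulrA => -> /eqP; rewrite mulr1 (negPf dn1).
have dC : d * d^* = 1 by rewrite -normCK d1 expr1n.
have eC : e * e^* = 1 by rewrite -normCK e1 expr1n.
have [k Nx xE] := level Sx; have [l Ny yE] := level Sy.
have kl : k + l = 0.
  apply: level_inj; rewrite expfzDr ?lt0r_neq0 // -Nx -Ny.
  have := congr1 (fun z => `|z| ^+ 2) dxy.
  by rewrite !normrM d1 mul1r normr1 exprMn expr1n.
have yV : y = (d * x)^-1.
  have dx0 : d * x != 0 by apply: contra_eq_neq dxy => ->; rewrite mul0r eq_sym oner_eq0.
  by apply: (mulfI dx0); rewrite dxy mulfV.
have {kl} lk : l = - k by rewrite -[RHS]add0r -kl addrAC subrr add0r.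
subst l; case: xE => [[? xb] | [[? xb] | [[? xg] | [[? xg] | [? xD]]]]]; subst k;
case: yE => [[? yb] | [[? yb] | [[? yg] | [[? yg] | [? yD]]]]] //.
- by case: (dpq b b^-1); rewrite ?mulfV ?lt0r_neq0 // -yb -xb.
- by case: (dpq b^-1 b); rewrite ?mulVf ?lt0r_neq0 // -xb -yb.
- move: dxy; case: xg => ->; case: yg => -> dxy'.
  + by case: (dpq g g^-1); rewrite ?mulfV.
  + by right; apply: (mulIf g0); rewrite mulfVK // -[LHS](mulfVK gC0) dxy' mul1r.
  + left; split; last by right.
    by apply: (mulIf gC0); rewrite mulfVK // -[LHS](mulfVK g0) dxy' mul1r.
  + by case: (dpq g^* (g^*)^-1); rewrite ?mulfV.
- move: dxy; case: xg => ->; case: yg => -> dxy'.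
  + by case: (dpq g^-1 g); rewrite ?mulVf.
  + left; split; last by left.
    by apply: (mulIf gC0); rewrite mulfVK // -[LHS](mulfVK g0) [d * _ / _]mulrAC dxy' mul1r.
  + by right; apply: (mulIf g0);
    rewrite mulfVK // -[LHS](mulfVK gC0) [d * _ / _]mulrAC dxy' mul1r.
  + by case: (dpq (g^*)^-1 g^*); rewrite ?mulVf.
- have ndC : d^* != x /\ d^* != y.
    split; apply: contraNneq S1 => Ed; [move: Sy | move: Sx].
      by rewrite (_ : y = 1) //; rewrite -dxy -Ed dC mul1r.
    by rewrite (_ : x = 1) //; rewrite -dxy mulrAC -Ed dC mul1r.
  case: ndC => /negPf dx /negPf dy; move/negPf: xd => xd; move/negPf: yd => yd.
  rewrite !inE xd (eq_sym x) dx /= in xD; rewrite !inE yd (eq_sym y) dy /= in yD.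
  case/orP: xD => /eqP xe; case/orP: yD => /eqP ye; rewrite xe ye ?eqxx // in dxy xy *.
    by case: (dpq e e^*).
  by case: (dpq e^* e); rewrite // mulrC.
Qed.

Lemma unit_conjugate_quotient : d = g / g^* \/ d = g^* / g.
Proof.
have [||nu [nub nuS]] := autS (x := b) (y := d); rewrite ?inE ?eqxx ?orbT //.
have S_b : b \in S by rewrite !inE eqxx.
have S_g : g \in S by rewrite !inE eqxx !orbT.
have S_gC : g^* \in S by rewrite !inE eqxx !orbT.
have b_real : b^* = b by apply/CrealP/gtr0_real.
have [||||||[-> _]|->] := triple (x := nu g) (y := nu g^*); try by [left | right].
- by rewrite -nub -!rmorphM relC rmorph1.
- exact: nuS.
- exact: nuS.
- by rewrite fmorph_eq.
- rewrite -nub fmorph_eq; apply: contraNneq g_nreal => gb.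
  by rewrite gb b_real.
- rewrite -nub fmorph_eq; apply: contraNneq g_nreal => gb.
  by rewrite -[g]conjCK gb !b_real.
Qed.

(** Let [nu g = d]. By [triple], [nu g^*] is [g^*] or [g^-1], so [nu d = d / nu g^*] has level 1 or
    -1. Comparison with the members of [S] of that level gives [d = 1] or [d = g^* / g], and either
    one makes [d ^+ 2 = 1]. *)
Lemma no_single_unit_pair : e = d -> d = g / g^* -> False.
Proof.
move=> ed dgg.
have S_b : b \in S by rewrite !inE eqxx.
have S_g : g \in S by rewrite !inE eqxx !orbT.
have S_gC : g^* \in S by rewrite !inE eqxx !orbT.
have S_d : d \in S by rewrite !inE eqxx !orbT.
have b_real : b^* = b by apply/CrealP/gtr0_real.
have d_n1 : d <> 1 by move=> E; have := sq_n1 S_d; rewrite E mulr1 eqxx.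
have ndV : d <> g^* / g.
  by move=> E; have := sq_n1 S_d; rewrite {1}dgg E mulrA mulfVK // mulfV // eqxx.
have [||nu [nug nuS]] := autS (x := g) (y := d); rewrite // -/S.
have lev_eq z k j : `|z| ^+ 2 = b ^ k -> `|z| ^+ 2 = b ^ j -> k = j.
  move=> -> E; apply/eqP; rewrite -subr_eq0; apply/eqP/level_inj.
  by rewrite expfzDr ?lt0r_neq0 // E -expfzDr ?lt0r_neq0 // subrr.
have nud : nu d = d / nu g^* by rewrite {1}dgg fmorph_div nug.
have Sd := nuS d S_d.
have [||||||[_ xyE]|//] := triple (x := nu b) (y := nu g^*).
- by rewrite -nug -!rmorphM [g * b]mulrC relC rmorph1.
- exact: nuS.
- exact: nuS.
- by rewrite fmorph_eq; apply: contraNneq g_nreal => bg; rewrite -[g]conjCK -bg !b_real.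
- by rewrite -nug fmorph_eq; apply: contraNneq g_nreal => <-; rewrite b_real.
- by rewrite -nug fmorph_eq eq_sym.
have [k Nk] := level Sd; case: xyE => [[_ yE]|[_ yE]]; rewrite yE in nud.
  have k1 : k = 1.
    apply: lev_eq Nk _.
    by rewrite nud normrM d1 mul1r normfV norm_conjC exprVn norm_g exprN1 invrK.
  rewrite k1; case=> [[//]|[[//]|[[//]|[[_ []]|[//]]]]]; rewrite nud => E.
    by apply: ndV; rewrite -[LHS](mulfVK gC0) E mulrC.
  by apply: d_n1; apply: (mulIf (invr_neq0 gC0)); rewrite E mul1r.
rewrite invrK in nud.
have k1 : k = -1 by apply: lev_eq Nk _; rewrite nud normrM d1 mul1r.
rewrite k1; case=> [[//]|[[//]|[[_ []]|[[//]|[//]]]]]; rewrite nud => E.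
  by apply: d_n1; apply: (mulIf g0); rewrite E mul1r.
by apply: ndV; apply: (mulIf g0); rewrite mulfVK.
Qed.

End TwoRealConjugates.

Lemma minCpoly_uniq_roots (x : algC) (r : seq algC) :
  minCpoly x = \prod_(z <- r) ('X - z%:P) -> uniq r.
Proof.
move=> Dr; rewrite -separable_prod_XsubC -Dr.
have [K [f [[|u []] // [<-] _]]] := num_field_exists [:: x].
rewrite -minCpoly_rmorph separable_map.
by apply: pcharf0_separable => p; rewrite -(fmorph_pchar f) pchar_num.
Qed.

(** * Conjugates of a unit of full degree *)

Section FullDegreeUnit.

Variables (K : fieldExtType rat) (s t : nat) (sigma : nat -> {rmorphism K -> algC}).
Variable u : K.
Hypotheses (sigmaP : labelled_embeddings s t sigma) (st : (1 <= s < t)%N).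
Hypothesis degu : adjoin_degree 1%AS u = (s + 2 * t)%N.
Hypotheses (u_i : condition_i s sigma u) (u_ii : condition_ii s t sigma u).

Local Notation c i := (sigma i u).
Local Notation d := (s + 2 * t)%N.

(** The minimal polynomial has [d] distinct roots, all of them among the [d] values [c i], so no
    value repeats. *)
Lemma conjugates_inj i j : (1 <= i <= d)%N -> (1 <= j <= d)%N -> c i = c j -> i = j.
Proof.
have [r Dr] := closed_field_poly_normal (minCpoly (c 1)).
rewrite (monicP (minCpoly_monic _)) scale1r in Dr.
have szr : size r = d.
  apply: succn_inj; rewrite -(size_prod_XsubC r id) -Dr -minCpoly_rmorph.
  by rewrite size_map_poly size_minPoly degu.
have sub_r : {subset r <= mkseq (fun i => c i.+1) d}.
  move=> y; rewrite -root_prod_XsubC -Dr => /conj_aut[nu <-].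
  have [k kd] := embeddings_exhaustive sigmaP (nu \o sigma 1).
  move/(_ u) => /= ->; apply/mapP; exists k.-1; first by rewrite mem_iota; lia.
  by rewrite prednK //; lia.
have := leq_size_uniq (minCpoly_uniq_roots Dr) sub_r.
rewrite size_mkseq szr => /(_ (leqnn _))/mkseq_uniqP c_inj.
move=> id jd cij; have := c_inj i.-1 j.-1; rewrite !inE !prednK; try lia.
by move/(_ _ _ cij); lia.
Qed.

Lemma conjugate_sq_n1 i : (1 <= i <= d)%N -> c i * c i != 1.
Proof.
move=> id; rewrite -rmorphM fmorph_eq1 -expr2 sqrf_eq1.
apply/norP; split; apply: contraTneq isT => u1.
  have E : c 1 = c 2 by rewrite u1 !rmorph1.
  by have := @conjugates_inj 1 2 ltac:(lia) ltac:(lia) E.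
have E : c 1 = c 2 by rewrite u1 !rmorphN1.
by have := @conjugates_inj 1 2 ltac:(lia) ltac:(lia) E.
Qed.

Lemma conjugate_real i : (1 <= i <= d)%N -> c i \is Num.real -> (i <= s)%N.
Proof.
move=> id /CrealP ci; rewrite leqNgt; apply/negP => lt_si.
have [le_it | lt_ti] := leqP i (s + t).
  have := embeddings_conj sigmaP (j := (i - s)%N) ltac:(lia) u.
  by rewrite subnKC ?ci; [move/conjugates_inj; lia | lia].
have := embeddings_conj sigmaP (j := (i - (s + t))%N) ltac:(lia) u.
rewrite subnKC ?(ltnW lt_ti) // => /(congr1 Num.conj); rewrite conjCK ci.
by move/conjugates_inj; lia.
Qed.

Lemma inverse_real_conjugate i : (1 <= i <= s)%N ->
  exists2 j, (1 <= j <= s)%N & c i * c j = 1.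
Proof.
move=> ids; have [_ lt_st] := andP st.
have [j jd jE] := inverse_conjugate sigmaP (sigma i) lt_st u_ii.
have ci0 : c i != 0.
  by apply: contra_eq_neq (u_i ids) => ->; rewrite mul0r eq_sym oner_eq0.
exists j; last by rewrite jE mulfV.
have [-> _] := andP jd; apply: conjugate_real => //.
by rewrite jE realV (embeddings_real sigmaP).
Qed.

(** With [s < t] the bound leaves [s <= 3]. Inversion is an involution of the real conjugates
    without fixed points, so [s] is neither 1 nor 3. *)
Lemma two_real_embeddings : (d < 12)%N -> s = 2%N.
Proof.
move=> d12; have inv_neq i j : (1 <= i <= s)%N -> c i * c j = 1 -> i != j.
  move=> ids; apply: contra_eq_neq => <-.
  by apply: conjugate_sq_n1; lia.
have inv_inj i j k : (1 <= i <= s)%N -> (1 <= j <= s)%N -> (1 <= k <= s)%N ->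
    c i * c j = 1 -> c j * c k = 1 -> i = k.
  move=> ids js ks ij jk; apply: conjugates_inj; try lia.
  have cj0 : c j != 0 by apply: contra_eq_neq jk => ->; rewrite mul0r eq_sym oner_eq0.
  by apply: (mulfI cj0); rewrite jk mulrC.
have [s1 | s3] : s = 1%N \/ s = 3%N \/ s = 2%N by lia.
  have [j js ij] := @inverse_real_conjugate 1 ltac:(lia).
  by have := inv_neq 1%N j ltac:(lia) ij; lia.
case: s3 => // s3.
have [j1 js1 E1] := @inverse_real_conjugate 1 ltac:(lia).
have [j2 js2 E2] := @inverse_real_conjugate 2 ltac:(lia).
have [j3 js3 E3] := @inverse_real_conjugate 3 ltac:(lia).
have n1 := inv_neq 1%N j1 ltac:(lia) E1.
have n2 := inv_neq 2%N j2 ltac:(lia) E2.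
have n3 := inv_neq 3%N j3 ltac:(lia) E3.
have [h1 h2 h3] : [/\ 1 <= 1 <= s, 1 <= 2 <= s & 1 <= 3 <= s]%N by rewrite s3.
have [?|[?|?]] : j1 = 1%N \/ j1 = 2%N \/ j1 = 3%N by lia.
all: subst j1; try (by rewrite eqxx in n1).
all: have [?|[?|?]] : j2 = 1%N \/ j2 = 2%N \/ j2 = 3%N by lia.
all: subst j2; try (by rewrite eqxx in n2).
all: have [?|[?|?]] : j3 = 1%N \/ j3 = 2%N \/ j3 = 3%N by lia.
all: subst j3; try (by rewrite eqxx in n3).
all: by first [have := inv_inj _ _ _ h1 h2 h3 E1 E2 | have := inv_inj _ _ _ h2 h1 h3 E2 E1
  | have := inv_inj _ _ _ h1 h3 h2 E1 E3 | have := inv_inj _ _ _ h3 h1 h2 E3 E1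
  | have := inv_inj _ _ _ h2 h3 h1 E2 E3 | have := inv_inj _ _ _ h3 h2 h1 E3 E2].
Qed.

Lemma full_degree_ge12 : (12 <= d)%N.
Proof.
rewrite leqNgt; apply/negP => d12; have s2 := two_real_embeddings d12.
have tE : t = 3%N \/ t = 4%N by lia.
have conjE k : (1 <= k <= t)%N -> c (2 + t + k)%N = (c (2 + k)%N)^*.
  by move=> kt; have := embeddings_conj sigmaP kt u; rewrite s2.
have norm1 k : (3 <= k <= t)%N -> `|c (2 + k)%N| = 1.
  by move=> kt; rewrite -s2; apply: u_ii; lia.
(* Here [c 3] goes with [c 1] in (i), and [c 4] with [c 2]; the pairs from [c 5] on lie on the
   circle. The last pair [e] is [dl] itself when [t = 3]. *)
pose b := c 1; pose g := c 3; pose dl := c 5; pose e := c (2 + t)%N.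
have e_dl : t = 4%N -> e <> dl /\ e <> dl^*.
  move=> t4; rewrite /e /dl -(conjE 3%N) t4 //.
  by split=> /conjugates_inj; rewrite s2 t4 => /(_ isT isT).
have bg : b * `|g| ^+ 2 = 1 by have := @u_i 1; rewrite s2; apply.
have b0 : b != 0.
  by apply: contra_eq_neq bg => ->; rewrite mul0r eq_sym oner_eq0.
have b_gt0 : 0 < b.
  rewrite -[b]invrK invr_gt0 -(mulr1 b^-1) -bg mulKf // exprn_gt0 // normr_gt0.
  by apply: contra_eq_neq bg => ->; rewrite normr0 expr0n mulr0 eq_sym oner_eq0.
have b_n1 : b != 1.
  apply: contraTneq isT => b1; have := @conjugate_sq_n1 1 ltac:(lia).
  by rewrite -/b b1 mulr1 eqxx.
have c2 : c 2 = b^-1.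
  have [j js E] := @inverse_real_conjugate 1 ltac:(lia).
  have [j1|j2] : j = 1%N \/ j = 2%N by lia.
    by have := @conjugate_sq_n1 1 ltac:(lia); rewrite -{2}j1 E eqxx.
  by apply: (mulfI b0); rewrite mulfV // -E j2.
have g_nreal : g \isn't Num.real.
  by apply/negP => gr; have := @conjugate_real 3 ltac:(lia) gr; lia.
(* The conjugate [g^-1] is non-real and, up to complex conjugation, some [c (2 + k)]. Both [k = 1]
   and [k >= 3] would give [|g| = 1], hence [b = 1]. *)
have c4 : c 4 = g^-1 \/ c 4 = (g^*)^-1.
  have [_ lt_st] := andP st.
  have [i id iE] := inverse_conjugate sigmaP (sigma 3) lt_st u_ii; rewrite -/g in iE.
  have i2 : (2 < i)%N.
    rewrite ltnNge; apply: contra g_nreal => i2; rewrite -realV -iE.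
    by apply: (embeddings_real sigmaP); lia.
  have [k kt kE] : exists2 k, (1 <= k <= t)%N & i = (2 + k)%N \/ i = (2 + t + k)%N.
    have [le_it|lt_ti] := leqP i (2 + t).
      by exists (i - 2)%N; [lia | left; lia].
    by exists (i - (2 + t))%N; [lia | right; lia].
  have nk : `|c (2 + k)%N| = `|g|^-1.
    by rewrite -normfV -iE; case: kE => ->; rewrite ?conjE ?norm_conjC.
  have gn1 : `|g| ^+ 2 != 1.
    by apply: contraNneq b_n1 => g1; rewrite -bg g1 mulr1.
  have g0 : `|g| != 0 by rewrite normr_eq0; apply: contraNneq g_nreal => ->; rewrite real0.
  have [k1|[k2|k3]] : k = 1%N \/ k = 2%N \/ (3 <= k <= t)%N by lia.
  - case/eqP: gn1; rewrite expr2 -{1}[`|g|]invrK -nk k1 -/g mulVf //.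
  - subst k; case: kE => iE2; rewrite iE2 in iE; first by left.
    by right; rewrite -fmorphV -iE conjE //= conjCK.
  case/eqP: gn1; rewrite -[`|g|]invrK -nk norm1 // invr1 expr1n //.
have dl1 : `|dl| = 1 by apply: (norm1 3); lia.
have e1 : `|e| = 1 by apply: norm1; lia.
pose S := [:: b; b^-1; g; g^*; g^-1; (g^*)^-1; dl; dl^*; e; e^*].
have conj4 : (c 4)^* \in S /\ c 4 \in S.
  by case: c4 => ->; rewrite fmorphV /= ?conjCK !inE !eqxx !orbT.
have conjS k : (1 <= k <= t)%N -> c (2 + k)%N \in S /\ (c (2 + k)%N)^* \in S.
  move=> kt; have [->|[->|[->|->]]] : k = 1%N \/ k = 2%N \/ k = 3%N \/ k = t by lia.
  - by split; rewrite !inE eqxx !orbT.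
  - by case: conj4.
  - by split; rewrite !inE eqxx !orbT.
  by split; rewrite !inE eqxx !orbT.
have cS i : (1 <= i <= d)%N -> c i \in S.
  move=> id; have [->|[->|i2]] : i = 1%N \/ i = 2%N \/ (2 < i)%N by lia.
  - by rewrite mem_head.
  - by rewrite c2 !inE eqxx orbT.
  have [le_it|lt_ti] := leqP i (2 + t).
    by have [] := conjS (i - 2)%N ltac:(lia); rewrite (subnKC (ltnW i2)).
  rewrite -(subnKC (ltnW lt_ti)) conjE; last lia.
  by have [] := conjS (i - (2 + t))%N ltac:(lia).
have Sc z : z \in S -> exists2 i, (1 <= i <= d)%N & z = c i.
  have c4C : c (2 + t + 2)%N = (c 4)^* by rewrite conjE //; lia.
  rewrite !inE => /or4P[/eqP->|/eqP->|/eqP->|/or4P[/eqP->|/eqP->|/eqP->|/or4P[] /eqP->]].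
  - by exists 1%N; first lia.
  - by exists 2%N; first lia.
  - by exists 3%N; first lia.
  - by exists (2 + t + 1)%N; [lia | rewrite conjE //; lia].
  - case: c4 => c4; first by exists 4%N; first lia.
    by exists (2 + t + 2)%N; [lia | rewrite c4C c4 fmorphV /= conjCK].
  - case: c4 => c4; last by exists 4%N; first lia.
    by exists (2 + t + 2)%N; [lia | rewrite c4C c4 fmorphV].
  - by exists 5%N; first lia.
  - by exists (2 + t + 3)%N; [lia | rewrite conjE //; lia].
  - by exists (2 + t)%N; first lia.
  by exists (2 + t + t)%N; [lia | rewrite conjE //; lia].
have autS x y : x \in S -> y \in S ->
    exists nu : {rmorphism algC -> algC}, nu x = y /\ forall z, z \in S -> nu z \in S.
  move=> /Sc[i id ->] /Sc[j jd ->]; have [nu nuE] := emb_aut (sigma i) (sigma j) u.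
  exists nu; split=> // z /Sc[k kd ->].
  have [l ld] := embeddings_exhaustive sigmaP (nu \o sigma k).
  by move/(_ u) => /= ->; apply: cS.
have S_sq z : z \in S -> z * z != 1 by case/Sc => i id ->; apply: conjugate_sq_n1.
have S1 : 1 \notin S by apply/negP => /S_sq; rewrite mulr1 eqxx.
have SN1 : -1 \notin S by apply/negP => /S_sq; rewrite mulrNN mulr1 eqxx.
have gC : g != g^* by apply: contra g_nreal => /eqP gC; apply/CrealP.
(* Only the set of members of [S] matters, so [dl] and [e] may be swapped or conjugated. *)
have quot x y : [:: b; b^-1; g; g^*; g^-1; (g^*)^-1; x; x^*; y; y^*] =i S ->
    `|x| = 1 -> `|y| = 1 -> x = g / g^* \/ x = g^* / g.
  move=> eqS x1 y1; apply: (unit_conjugate_quotient b_gt0 b_n1 bg x1 y1) => //.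
    by rewrite eqS.
  move=> z w; rewrite !eqS => Sz Sw; have [nu [nuE nuS]] := autS z w Sz Sw.
  by exists nu; split=> // v; rewrite !eqS; apply: nuS.
have other x : [:: b; b^-1; g; g^*; g^-1; (g^*)^-1; x; x^*; x; x^*] =i S ->
    `|x| = 1 -> x = g / g^* -> False.
  move=> eqS x1; apply: (no_single_unit_pair b_gt0 b_n1 bg x1 x1) => //.
  - by rewrite eqS.
  - by rewrite eqS.
  move=> z w; rewrite !eqS => Sz Sw; have [nu [nuE nuS]] := autS z w Sz Sw.
  by exists nu; split=> // v; rewrite !eqS; apply: nuS.
have ggC : (g / g^*)^* = g^* / g by rewrite fmorph_div /= conjCK.
have dlE := quot dl e (fun z => erefl) dl1 e1.
have [t3|t4] := tE.
  have edl : e = dl by rewrite /e t3.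
  case: dlE => dlE; first by apply: (other dl) => // z; rewrite /S edl.
  apply: (other dl^*); rewrite ?norm_conjC //; last by rewrite dlE -ggC conjCK.
  move=> z; rewrite /S edl !inE conjCK.
  by case: (z == dl); case: (z == dl^*); rewrite ?orbT ?orbF.
(* The two quotients are complex conjugates of each other, so [e] would be [dl] or [dl^*], against
   the distinctness of the conjugates. *)
have eE : e = g / g^* \/ e = g^* / g.
  apply: (quot e dl) => // z; apply: perm_mem.
  by rewrite (perm_catAC [:: b; b^-1; g; g^*; g^-1; (g^*)^-1] [:: e; e^*] [:: dl; dl^*]).
have [ne neC] := e_dl t4.
by case: dlE eE => dlE [] eE; [case: ne | case: neC | case: neC | case: ne];
  rewrite dlE eE -?ggC ?conjCK.
Qed.

End FullDegreeUnit.

Lemma degree_attained_ge12 d : degree_attained d -> (12 <= d)%N.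
Proof.
case=> K [s [t [sigma [u [sigmaP [st [-> [_ [degu [u_i u_ii]]]]]]]]]].
exact: full_degree_ge12 sigmaP st degu u_i u_ii.
Qed.

(** * A unit of degree 12 *)

(* Vieta's relations for the roots of [x^3 - y x^2 - y x - 1]. *)
Definition vieta (R : comNzRingType) (y a b c : R) :=
  [/\ a * b * c = 1, a + b + c = y & a * b + b * c + c * a = - y].

Lemma vietaC (R : comNzRingType) (y a b c : R) : vieta y a b c -> vieta y b a c.
Proof. by case=> e3 e1 e2; split; [rewrite -e3 | rewrite -e1 | rewrite -e2]; ring. Qed.

Lemma vietaA (R : comNzRingType) (y a b c : R) : vieta y a b c -> vieta y b c a.
Proof. by case=> e3 e1 e2; split; [rewrite -e3 | rewrite -e1 | rewrite -e2]; ring. Qed.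

Lemma vieta_prod (R : comNzRingType) (y a b c x : R) : vieta y a b c ->
  (x - a) * (x - b) * (x - c) = x ^+ 3 - y * x ^+ 2 - y * x - 1.
Proof.
case=> e3 e1 e2; transitivity (x ^+ 3 - (a + b + c) * x ^+ 2
  + (a * b + b * c + c * a) * x - a * b * c); first by ring.
by rewrite e1 e2 e3 mulNr.
Qed.

Lemma vieta_root (F : fieldType) (y a b c x : F) : vieta y a b c ->
  x ^+ 3 - y * x ^+ 2 - y * x - 1 = 0 <-> [\/ x = a, x = b | x = c].
Proof.
move=> V; rewrite -(vieta_prod x V); split; last first.
  by case=> ->; rewrite subrr ?mulr0 ?mul0r ?mulr0 ?mul0r.
move/eqP; rewrite !mulf_eq0 !subr_eq0 -orbA.
by case/or3P=> /eqP; [constructor 1 | constructor 2 | constructor 3].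
Qed.

Lemma vieta_inv (F : fieldType) (y a b c : F) :
  vieta y a b c -> vieta (- y) a^-1 b^-1 c^-1.
Proof.
case=> e3 e1 e2.
have : a * b * c != 0 by rewrite e3 oner_eq0.
rewrite !mulf_eq0 !negb_or => /andP[/andP[a0 b0] c0].
split; first by rewrite -!invfM e3 invr1.
  by rewrite -e2 -[LHS]mulr1 -e3; field; rewrite a0 b0 c0.
by rewrite opprK -e1 -[LHS]mulr1 -e3; field; rewrite a0 b0 c0.
Qed.

Lemma vieta_exists (y : algC) : exists a b c, vieta y a b c.
Proof.
pose p : {poly algC} := Poly [:: -1; -y; -y; 1].
have Ep : p = [:: -1; -y; -y; 1] :> seq algC by rewrite (@PolyK _ 0) //= oner_eq0.
have [r Dr] := closed_field_poly_normal p.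
have lp : lead_coef p = 1 by rewrite lead_coefE Ep.
rewrite lp scale1r in Dr.
have : size r = 3%N by apply: succn_inj; rewrite -(size_prod_XsubC r id) -Dr Ep.
case: r Dr => [|a [|b [|c []]]] // Dr _; exists a, b, c.
have hp x : (x - a) * (x - b) * (x - c) = x ^+ 3 - y * x ^+ 2 - y * x - 1.
  have := congr1 (fun p => p.[x]) Dr; rewrite !big_cons big_nil /=.
  rewrite mulr1 mulrA !hornerM !hornerXsubC => <-; rewrite /p horner_Poly /=; ring.
have two0 : (2 : algC) != 0 by rewrite pnatr_eq0.
(* The values at 0, 1 and -1 determine the three elementary symmetric functions. *)
have h0 := hp 0; have h1 := hp 1; have hN1 := hp (-1).
have e3 : a * b * c = 1.
  transitivity (- ((0 - a) * (0 - b) * (0 - c))); first by ring.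
  by rewrite h0; ring.
have e12 : a + b + c + (a * b + b * c + c * a) = 0.
  transitivity (1 - a * b * c - ((-1 - a) * (-1 - b) * (-1 - c)) - 2); first by ring.
  rewrite hN1 e3; ring.
have e12' : (a * b + b * c + c * a) - (a + b + c) = - 2 * y.
  transitivity ((1 - a) * (1 - b) * (1 - c) - 1 + a * b * c); first by ring.
  by rewrite h1 e3; ring.
split=> //; apply: (mulfI two0).
  transitivity (a + b + c + (a * b + b * c + c * a)
     - ((a * b + b * c + c * a) - (a + b + c))); first by ring.
  by rewrite e12 e12'; ring.
transitivity (a + b + c + (a * b + b * c + c * a)
   + ((a * b + b * c + c * a) - (a + b + c))); first by ring.
by rewrite e12 e12'; ring.
Qed.

(** The quantity [y ^+ 4 - 18 * y ^+ 2 - 27] is the discriminant of the cubic. Three real roots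
    would make it a square of a real number; a non-real root brings its complex conjugate along. *)
Lemma vieta_real (y : algC) : y \is Num.real -> y ^+ 4 - 18 * y ^+ 2 - 27 < 0 ->
  exists a b, vieta y a b b^* /\ b \isn't Num.real.
Proof.
move=> y_real disc; have [a0 [b0 [c0 V0]]] := vieta_exists y.
have [a [b [c [V nb]]]] : exists a b c, vieta y a b c /\ b \isn't Num.real.
  have [a_real|] := boolP (a0 \is Num.real); last first.
    by move=> na; exists b0, a0, c0; split=> //; apply: vietaC.
  have [b_real|] := boolP (b0 \is Num.real); last by move=> nb; exists a0, b0, c0.
  have [c_real|] := boolP (c0 \is Num.real); last first.
    by move=> nc; exists b0, c0, a0; split=> //; apply: vietaA.
  case: V0 => e3 e1 e2; exfalso.
  have : 0 <= ((a0 - b0) * (b0 - c0) * (c0 - a0)) ^+ 2.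
    by rewrite real_exprn_even_ge0 // !realM // realB.
  rewrite (_ : _ ^+ 2 = y ^+ 4 - 18 * y ^+ 2 - 27) ?(lt_geF disc) //.
  transitivity ((a0 + b0 + c0) ^+ 2 * (a0 * b0 + b0 * c0 + c0 * a0) ^+ 2
    - 4 * (a0 * b0 + b0 * c0 + c0 * a0) ^+ 3
    - 4 * (a0 + b0 + c0) ^+ 3 * (a0 * b0 * c0)
    + 18 * (a0 + b0 + c0) * (a0 * b0 + b0 * c0 + c0 * a0) * (a0 * b0 * c0)
    - 27 * (a0 * b0 * c0) ^+ 2); first by ring.
  by rewrite e1 e2 e3; ring.
have rb : b ^+ 3 - y * b ^+ 2 - y * b - 1 = 0 by apply/(vieta_root b V); constructor 2.
have : [\/ b^* = a, b^* = b | b^* = c].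
  apply/(vieta_root b^* V); have := congr1 Num.conj rb.
  by rewrite !rmorphB rmorphXn !rmorphM rmorph0 rmorph1 /= (CrealP y_real).
case=> [bC|/CrealP bC|bC]; last by exists a, b; rewrite bC.
  by exists c, b; rewrite bC; split=> //; apply/vietaC/vietaA.
by rewrite bC in nb.
Qed.

(** The two summands have the same argument, so the norm is [|a| + |a|^-1]. *)
Lemma normD_inv_conj (a : algC) : a != 0 -> 2 <= `|a + (a^*)^-1|.
Proof.
move=> a0; have m0 : 0 < `|a| by rewrite normr_gt0.
have -> : `|a + (a^*)^-1| = `|a| + `|a|^-1.
  rewrite (_ : a + _ = a * (1 + (`|a| ^+ 2)^-1)).
    rewrite normrM [X in _ * X]ger0_norm; last by rewrite addr_ge0 // invr_ge0 exprn_ge0.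
    by field; rewrite gt_eqF.
  by rewrite normCK; field; rewrite a0 conjC_eq0 a0.
rewrite -subr_ge0 (_ : _ - 2 = (`|a| - 1) ^+ 2 / `|a|); last first.
  by field; rewrite gt_eqF.
by rewrite divr_ge0 // real_exprn_even_ge0 // realB.
Qed.

(** As [w^* = - w], the map taking [z] to the inverse of [z^*] permutes the roots. If it moves [a],
    the third root has norm 1 because the product is 1, and the sum of the roots has norm at least
    [2 - 1], against [|w| < 1]. *)
Lemma vieta_unit_circle (w a b c : algC) :
  w^* = - w -> `|w| < 1 -> vieta w a b c -> `|a| = 1.
Proof.
move=> wC w1 V; have [e3 e1 _] := V.
have a0 : a != 0 by apply: contra_eq_neq e3 => ->; rewrite !mul0r eq_sym oner_eq0.
have aC0 : a^* != 0 by rewrite conjC_eq0.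
have norm_c z t : a * z * t = 1 -> z = (a^*)^-1 -> `|t| = 1.
  move=> azt zE; have := congr1 (fun x => `|x|) azt.
  by rewrite zE !normrM normfV norm_conjC mulfV ?normr_eq0 // mul1r normr1.
have big z t : a + z + t = w -> z = (a^*)^-1 -> `|t| = 1 -> `|a| = 1.
  move=> azt zE t1; suff : 1 <= `|w| by move/le_lt_trans/(_ w1); rewrite ltxx.
  have := ler_normB w t; rewrite -{1}azt addrK zE t1 => h.
  by rewrite -(lerD2r 1) (le_trans _ h) // (le_trans _ (normD_inv_conj a0)).
have ra : a ^+ 3 - w * a ^+ 2 - w * a - 1 = 0 by apply/(vieta_root a V); constructor 1.
have : [\/ (a^*)^-1 = a, (a^*)^-1 = b | (a^*)^-1 = c].
  apply/(vieta_root _ V); have := congr1 Num.conj ra.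
  rewrite !rmorphB rmorphXn !rmorphM rmorph0 rmorph1 /= wC => E.
  apply: (mulfI (expf_neq0 3 aC0)); rewrite mulr0 -oppr0 -E; field.
  by rewrite aC0.
case=> [aE|bE|cE].
- apply/eqP; rewrite -(pexpr_eq1 (ltn0Sn 1)) // normCK -{1}aE mulVf //.
- by apply: (big b c) => //; apply: (norm_c b c).
apply: (big c b _ (esym cE)); first by rewrite addrAC.
by apply: norm_c (esym cE); rewrite mulrAC.
Qed.

(* Coefficients of [(x^3 - 1)^4 - 6 (x^3 - 1)^2 (x^2 + x)^2 - 3 (x^2 + x)^4] at
   [x = 1 + X]; the shift makes it an Eisenstein polynomial at 3. *)
Definition degree12_coefs : seq int :=
  [:: -48; -288; -960; -2160; -3240; -3168; -1920; -576; 72; 144; 60; 12; 1].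

Lemma degree12_coefsK : Poly degree12_coefs = degree12_coefs :> seq int.
Proof. by rewrite (@PolyK _ 0). Qed.

Lemma degree12_irreducible :
  irreducible_poly (map_poly intr (Poly degree12_coefs) : {poly rat}).
Proof.
apply/irreducible_rat_int; apply: (@eisenstein_crit 3) => //.
- by rewrite degree12_coefsK.
- by rewrite lead_coefE degree12_coefsK.
- by rewrite degree12_coefsK.
by rewrite degree12_coefsK; do 12!case=> //.
Qed.

Lemma degree12_expand (R : comNzRingType) (x : R) :
  (map_poly intr (Poly degree12_coefs)).[x - 1] =
  (x ^+ 3 - 1) ^+ 4 - 6 * (x ^+ 3 - 1) ^+ 2 * (x ^+ 2 + x) ^+ 2 - 3 * (x ^+ 2 + x) ^+ 4.
Proof.
by rewrite /degree12_coefs map_Poly_id0 // horner_Poly /=; ring.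
Qed.

Lemma minCpoly_irreducible (p : {poly rat}) (x : algC) :
  irreducible_poly p -> p \is monic -> root (map_poly ratr p) x ->
  minCpoly x = map_poly ratr p.
Proof.
move=> [_ irr_p] mon_p px; have [q [Dq mon_q] dv_q] := minCpolyP x.
rewrite Dq; congr map_poly; apply/eqP; rewrite -eqp_monic //; apply: irr_p.
  by apply/eqP => q1; have := size_minCpoly x; rewrite Dq size_map_poly q1.
by rewrite -dv_q.
Qed.

(** The hypotheses say that [z^4 - 6 z^2 - 3] factors as [(z^2 - y^2) (z^2 - w^2)]; the product of
    the cubics over the parameters [y], [-y], [w], [-w] is the norm. *)
Lemma quartic_product (R : comNzRingType) (x y w : R) :
  y ^+ 2 + w ^+ 2 = 6 -> y ^+ 2 * w ^+ 2 = -3 ->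
  (x ^+ 3 - y * x ^+ 2 - y * x - 1) * (x ^+ 3 - - y * x ^+ 2 - - y * x - 1) *
  ((x ^+ 3 - w * x ^+ 2 - w * x - 1) * (x ^+ 3 - - w * x ^+ 2 - - w * x - 1)) =
  (x ^+ 3 - 1) ^+ 4 - 6 * (x ^+ 3 - 1) ^+ 2 * (x ^+ 2 + x) ^+ 2 - 3 * (x ^+ 2 + x) ^+ 4.
Proof.
move=> e1 e2; transitivity ((x ^+ 3 - 1) ^+ 4
    - (y ^+ 2 + w ^+ 2) * (x ^+ 3 - 1) ^+ 2 * (x ^+ 2 + x) ^+ 2
    + y ^+ 2 * w ^+ 2 * (x ^+ 2 + x) ^+ 4); first by ring.
by rewrite e1 e2; ring.
Qed.

(* [y^2 = 3 + 2 sqrt 3] and [w^2 = 3 - 2 sqrt 3] are the roots of [z^2 - 6 z - 3]. *)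
Lemma parameters_exist : exists y w : algC,
  [/\ y \is Num.real, y ^+ 4 - 18 * y ^+ 2 - 27 < 0, w^* = - w & `|w| < 1]
  /\ (y ^+ 2 + w ^+ 2 = 6 /\ y ^+ 2 * w ^+ 2 = -3).
Proof.
pose r : algC := sqrtC 3; have r2 : r ^+ 2 = 3 by rewrite sqrtCK.
have r0 : 0 <= r by rewrite sqrtC_ge0 ler0n.
(* From [9 < 12 < 16]; these bounds place [q = - w ^+ 2] strictly between 0 and 1. *)
have r_gt : 3 < 2 * r.
  rewrite -(ltr_pXn2r (ltn0Sn 1)) ?nnegrE ?mulr_ge0 // exprMn r2.
  by rewrite -natrX -natrX -natrM ltr_nat.
have r_lt : 2 * r < 4.
  rewrite -(ltr_pXn2r (ltn0Sn 1)) ?nnegrE ?mulr_ge0 // exprMn r2.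
  by rewrite -natrX -natrX -natrM ltr_nat.
pose p : algC := 3 + 2 * r; pose q : algC := 2 * r - 3.
have p0 : 0 <= p by rewrite addr_ge0 ?mulr_ge0.
have q0 : 0 <= q by rewrite subr_ge0 ltW.
exists (sqrtC p), ('i * sqrtC q); rewrite exprMn sqrCi !sqrtCK; split; last first.
  split; rewrite /p /q; first by ring.
  transitivity (9 - 4 * r ^+ 2); first by ring.
  by rewrite r2; ring.
split.
- by rewrite ger0_real // sqrtC_ge0.
- rewrite (exprM _ 2 2) sqrtCK (_ : _ - 27 = - (24 * r + 60)).
    by rewrite oppr_lt0 ltr_wpDl ?mulr_ge0 // ltr0n.
  by rewrite /p; transitivity (4 * r ^+ 2 - 24 * r - 72); [ring | rewrite r2; ring].
- by rewrite rmorphM /= conjCi mulNr (CrealP (ger0_real _)) // sqrtC_ge0.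
rewrite normrM normCi mul1r ger0_norm ?sqrtC_ge0 //.
rewrite -(ltr_pXn2r (ltn0Sn 1)) ?nnegrE ?sqrtC_ge0 // sqrtCK expr1n.
by rewrite ltrBlDr (_ : 1 + 3 = 4) //; ring.
Qed.

(** * The field of degree 12 and its embeddings *)

Lemma emb_eq (K : fieldExtType rat) (u : K) (f g : {rmorphism K -> algC}) :
  <<1; u>>%VS = fullv -> f u = g u -> f =1 g.
Proof.
move=> genK fgu x; have /Fadjoin_polyP[p /polyOver1P[q ->] ->] : x \in <<1; u>>%VS.
  by rewrite genK memvf.
rewrite -!horner_map fgu -!map_poly_comp; congr _.[_]; apply: eq_map_poly => a /=.
by rewrite !rmorphZ_num !rmorph1.
Qed.

Lemma vieta_polyC (R : comNzRingType) (y a b c : R) :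
  vieta y a b c -> vieta y%:P a%:P b%:P c%:P.
Proof.
case=> e3 e1 e2.
by split; rewrite -?polyCM -?polyCM -?polyCD -?polyCD -?polyCN ?e1 ?e2 ?e3.
Qed.

(** The order is that of the labelling for [s = 2], [t = 5]: two real conjugates, five non-real
    ones, then their complex conjugates. *)
Definition degree12_conjugates (b g d1 d2 d3 : algC) :=
  [:: b; b^-1; g; g^-1; d1; d2; d3; g^*; (g^-1)^*; d1^*; d2^*; d3^*].

(** The parameter [y] contributes [b], [g], [g^*], and [- y] their inverses; [w] contributes [d1],
    [d2], [d3], and [- w] their inverses, which are their complex conjugates. *)
Lemma degree12_roots : exists b g d1 d2 d3 : algC,
  [/\ b * `|g| ^+ 2 = 1, `|d1| = 1, `|d2| = 1, `|d3| = 1 &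
    map_poly intr (Poly degree12_coefs) =
    \prod_(r <- degree12_conjugates b g d1 d2 d3) ('X - (r - 1)%:P)].
Proof.
have [y [w [[y_real y_disc wC w1] [ywD ywM]]]] := parameters_exist.
have [b [g [V _]]] := vieta_real y_real y_disc.
have [d1 [d2 [d3 W]]] := vieta_exists w.
have n1 := vieta_unit_circle wC w1 W.
have n2 := vieta_unit_circle wC w1 (vietaA W).
have n3 := vieta_unit_circle wC w1 (vietaA (vietaA W)).
exists b, g, d1, d2, d3; split=> //; first by have [<- _ _] := V; rewrite normCK mulrA.
have V' := vieta_inv V; have W' := vieta_inv W.
rewrite -fmorphV /= in V'; rewrite !inv_norm1 // in W'.
rewrite -[LHS]comp_polyXr /comp_poly -map_poly_comp.
rewrite (eq_map_poly (g := intr)); last by move=> z /=; rewrite rmorph_int.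
(* Writing the variable as [('X + 1) - 1] lets [degree12_expand] apply over the polynomial ring. *)
rewrite -[X in horner _ X](addrK 1) degree12_expand.
rewrite -(quartic_product _ (y := y%:P) (w := w%:P)).
- have VP' := vieta_polyC V'; have WP' := vieta_polyC W'; rewrite !polyCN in VP' WP'.
  rewrite -(vieta_prod _ (vieta_polyC V)) -(vieta_prod _ VP').
  rewrite -(vieta_prod _ (vieta_polyC W)) -(vieta_prod _ WP').
  have XE r : 'X - (r - 1)%:P = 'X + 1 - r%:P :> {poly algC}.
    by rewrite polyCB; ring.
  rewrite /degree12_conjugates !big_cons big_nil !XE.
  move: (_ - b%:P) (_ - b^-1%:P) (_ - g%:P) (_ - g^-1%:P) (_ - (g^*)%:P) => p1 p2 p3 p4 p5.
  move: (_ - (g^-1^*)%:P) (_ - d1%:P) (_ - d2%:P) (_ - d3%:P) => p6 p7 p8 p9.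
  move: (_ - (d1^*)%:P) (_ - (d2^*)%:P) (_ - (d3^*)%:P) => p10 p11 p12.
  by ring.
- by rewrite -!polyC_exp -polyCD ywD polyC_natr.
- by rewrite -!polyC_exp -polyCM ywM polyCN polyC_natr.
Qed.

Lemma degree_attained_12 : degree_attained 12.
Proof.
have [b [g [d1 [d2 [d3 [bg n1 n2 n3 Ers]]]]]] := degree12_roots.
set rs := degree12_conjugates b g d1 d2 d3 in Ers.
have [K [f [[|u []] // [Du] genK]]] := num_field_exists [:: b].
rewrite adjoin_seq1 in genK.
pose E := map_poly intr (Poly degree12_coefs) : {poly rat}.
have EC : map_poly ratr E = \prod_(r <- rs) ('X - (r - 1)%:P) :> {poly algC}.
  rewrite -Ers -map_poly_comp; apply: eq_map_poly => z /=; exact: ratr_int.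
have rootE r : r \in rs -> root (map_poly ratr E) (r - 1).
  move=> rrs; rewrite EC -(big_map (fun r => r - 1) xpredT (fun z => 'X - z%:P)).
  by rewrite root_prod_XsubC; apply/mapP; exists r.
have monE : E \is monic.
  by apply: monic_map; rewrite monicE lead_coefE degree12_coefsK.
have minb : minCpoly (b - 1) = map_poly ratr E.
  apply: minCpoly_irreducible degree12_irreducible monE _.
  by apply: rootE; rewrite mem_head.
have uniq_rs : uniq rs.
  rewrite -(map_inj_uniq (addIr (- 1))); apply: (@minCpoly_uniq_roots (b - 1)).
  by rewrite minb EC big_map.
(* By irreducibility every entry of [rs] is a conjugate of [b]. Outside the list any morphism will
   do. *)
have nuP (i : nat) : {nu : {rmorphism algC -> algC} | (i < 12)%N -> nu b = rs`_i}.
  have [lti|] := ltnP i 12; last by exists idfun.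
  have [|nu nuE] := @conj_aut (b - 1) (rs`_i - 1).
    by rewrite minb; apply: rootE; apply: mem_nth.
  by exists nu => _; apply: (addIr (- 1)); rewrite -nuE rmorphB rmorph1.
pose sigma (i : nat) : {rmorphism K -> algC} := sval (nuP i.-1) \o f.
have sigE i : (1 <= i <= 12)%N -> sigma i u = rs`_i.-1.
  by move=> i12; rewrite /sigma /= Du; case: (nuP _) => nu /= -> //; lia.
have conj_rs j : (1 <= j <= 5)%N -> sigma (7 + j)%N u = (sigma (2 + j)%N u)^*.
  by move=> j5; rewrite !sigE; try lia; case: j j5 => [|[|[|[|[|[|j]]]]]].
have size_rs : size rs = 12%N by [].
have sig_inj i j : (1 <= i <= 12)%N -> (1 <= j <= 12)%N -> sigma i u = sigma j u -> i = j.
  move=> i12 j12; rewrite !sigE // => /eqP; rewrite nth_uniq ?size_rs //; lia.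
have b_real : b \is Num.real.
  by rewrite -realV (mulr1_eq bg) ger0_real // exprn_ge0.
have alg_int x : f x \in rs -> alg_integer x.
  move=> fx; rewrite /alg_integer -[x](subrK 1); apply: integral_add; last exact: integral1.
  exists (Poly degree12_coefs); first by rewrite monicE lead_coefE degree12_coefsK.
  rewrite -(fmorph_root f) rmorphB rmorph1 -map_poly_comp.
  rewrite (eq_map_poly (g := fun z => ratr z%:~R)) => [|z /=].
    by rewrite map_poly_comp; apply: rootE.
  by rewrite rmorph_int ratr_int.
have sig_cases i : (1 <= i <= 12)%N -> i = 1%N \/ i = 2%N \/
    exists2 j, (1 <= j <= 5)%N & i = (2 + j)%N \/ i = (7 + j)%N.
  move=> i12; have [i2|i2] := leqP i 2; first by lia.
  right; right; have [i7|i7] := leqP i 7.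
    by exists (i - 2)%N; [lia | left; lia].
  by exists (i - 7)%N; [lia | right; lia].
have s1E : sigma 1 u = b by rewrite sigE.
have s2E : sigma 2 u = b^-1 by rewrite sigE.
have b0 : b != 0 by apply: contra_eq_neq bg => ->; rewrite mul0r eq_sym oner_eq0.
have g2 : `|g| ^+ 2 = b^-1 by rewrite (mulr1_eq bg).
exists K, 2%N, 5%N, sigma, u; split; first split=> //.
- by move=> i j id jd eqs; apply: sig_inj.
- move=> tau; have : tau u \in rs.
    rewrite -(mem_map (addIr (- 1))) -root_prod_XsubC big_map -EC -minb.
    have := root_minCpoly (tau (u - 1)); rewrite (minCpoly_emb tau f).
    by rewrite !rmorphB !rmorph1 Du.
  move=> /(nthP 0)[i lti iE]; exists i.+1; first by [].
  by apply: (emb_eq genK); rewrite sigE.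
- move=> i i2 x; apply/CrealP.
  have conj_u : (sigma i u)^* = sigma i u.
    apply/CrealP; have [->|->] : i = 1%N \/ i = 2%N by lia.
      by rewrite s1E.
    by rewrite s2E realV.
  exact: (emb_eq (f := (Num.conj : {rmorphism algC -> algC}) \o sigma i) genK conj_u).
(* A real value would equal its complex conjugate, which is the value at another index. *)
- move=> i i12; exists u; apply/negP => /CrealP ur.
  have [|i1|[i2|[j j5 ij]]] := sig_cases i; try lia.
  have jC := conj_rs j j5; have : sigma (7 + j)%N u = sigma (2 + j)%N u.
    case: ij => ij; rewrite ij in ur; first by rewrite jC.
    by rewrite -ur jC conjCK.
  by move/sig_inj; lia.
- move=> j j5 x.
  exact: (emb_eq (g := (Num.conj : {rmorphism algC -> algC}) \o sigma (2 + j)%N) genK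
    (conj_rs j j5)).
split=> //; split=> //; split.
  split.
  - by rewrite -(fmorph_eq0 f) Du.
  - by apply: alg_int; rewrite Du mem_head.
  - by apply: alg_int; rewrite fmorphV Du !inE eqxx orbT.
split.
  (* The irreducible polynomial belongs to [u - 1], which generates the same field as [u]. *)
  have genK1 : <<1; u - 1>>%VS = fullv.
    apply/eqP; rewrite eqEsubv subvf -genK; apply/FadjoinP.
    rewrite sub1v -[X in X \in _](subrK 1) memvD ?memv_adjoin //.
    by rewrite (subvP (subv_adjoin _ _)) ?mem1v.
  apply: succn_inj; rewrite adjoin_degreeE genK -genK1 -adjoin_degreeE -size_minPoly.
  rewrite -(size_map_poly f) minCpoly_rmorph rmorphB rmorph1 Du minb EC.
  by rewrite (size_prod_XsubC rs (fun r => r - 1)).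
split=> j j5.
  have [->|->] : j = 1%N \/ j = 2%N by lia.
    by rewrite s1E sigE.
  by rewrite s2E sigE //= normfV exprVn g2 invrK mulVf.
have [->|[->|->]] : j = 3%N \/ j = 4%N \/ j = 5%N by lia.
all: by rewrite sigE.
Qed.

Local Close Scope ring_scope.

Theorem theorem2 :
  (degree_attained 12 /\
   forall d : nat, degree_attained d -> (12 <= d)%N) /\
  (forall (K : fieldExtType rat) (s t : nat)
          (sigma : nat -> {rmorphism K -> algC}),
     labelled_embeddings s t sigma ->
     (1 <= s < t)%N ->
     ~ exists U : K -> Prop,
         mul_subgroup_of (totally_positive_unit s sigma) U /\
         mul_rank U s /\
         (forall u : K, U u -> condition_i s sigma u /\ condition_ii s t sigma u)).
Proof.
split; first by split; [exact: degree_attained_12 | exact: degree_attained_ge12].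
move=> K s t sigma sigmaP st [U [Usub [Urk Ucond]]].
exact: no_unit_group_of_rank_s sigmaP st Usub Urk Ucond.
Qed.
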